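(* Let $\mathbb{X}$ be an override restriction category with override operator $\triangleright$. Then $\mathbb{X}$ has binary joins, where for all $f,g \in \mathbb{X}(A,B)$ with $f \smile g$, their join is $f \vee g = f \triangleright g$.
   Context: Composition is written diagrammatically: for $f:A\to B$ and $g:B\to C$, $fg:A\to C$ is $f$ followed by $g$. Composition binds more tightly than all other binary operations. A restriction category is a category $\mathbb{X}$ equipped with operations $\overline{(-)}:\mathbb{X}(A,B)\to\mathbb{X}(A,A)$ for all objects $A,B$ such that: [R.1] $\overline{f}f=f$ for $f\in\mathbb{X}(A,B)$; [R.2] $\overline{f}\,\overline{g}=\overline{g}\,\overline{f}$ for $f\in\mathbb{X}(A,B)$, $g\in\mathbb{X}(A,C)$; [R.3] $\overline{\overline{f}g}=\overline{f}\,\overline{g}$ for $f\in\mathbb{X}(A,B)$, $g\in\mathbb{X}(A,C)$; [R.4] $f\overline{g}=\overline{fg}f$ for $f\in\mathbb{X}(A,B)$, $g\in\mathbb{X}(B,C)$. For $f,g\in\mathbb{X}(A,B)$: $f\le g$ means $\overline{f}g=f$ (this is a partial order on each homset); $f\smile g$ ($f$ and $g$ are compatible) means $\overline{g}f=\overline{f}g$. A restriction category has binary joins if for all $f,g\in\mathbb{X}(A,B)$ with $f\smile g$ there is a map $f\vee g\in\mathbb{X}(A,B)$ such that: [J.1] $f\le f\vee g$ and $g\le f\vee g$; [J.2] for any $h\in\mathbb{X}(A,B)$, if $f\le h$ and $g\le h$ then $f\vee g\le h$; [J.3] for any $k\in\mathbb{X}(A',A)$, $k(f\vee g)=kf\vee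 kg$. An override restriction category is a restriction category $\mathbb{X}$ with binary operations $\triangleright:\mathbb{X}(A,B)\times\mathbb{X}(A,B)\to\mathbb{X}(A,B)$ for all objects $A,B$ (an override operator) such that: (1) $(f\triangleright g)\triangleright h=f\triangleright(g\triangleright h)$ for $f,g,h\in\mathbb{X}(A,B)$; (2) $f\triangleright\overline{f}g=f$ for $f,g\in\mathbb{X}(A,B)$; (3) $\overline{g}f\triangleright f=f$ for $f\in\mathbb{X}(A,B)$, $g\in\mathbb{X}(A,C)$; (4) $f(g\triangleright h)=fg\triangleright fh$ for $f\in\mathbb{X}(A,B)$, $g,h\in\mathbb{X}(B,C)$; (5) $\overline{f\triangleright g}\,h=\overline{f}h\triangleright\overline{g}h$ for $f,g\in\mathbb{X}(A,C)$, $h\in\mathbb{X}(A,B)$. *)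

(* Defs.v *)
From mathcomp Require Import ssreflect.

Set Implicit Arguments.
Unset Strict Implicit.
Unset Printing Implicit Defensive.

Declare Scope rcat_scope.
Delimit Scope rcat_scope with rcat.
Local Open Scope rcat_scope.

Reserved Notation "f ;; g" (at level 40, left associativity).
Reserved Notation "f |> g" (at level 50, left associativity).

Record category := Category {
  obj :> Type;
  hom : obj -> obj -> Type;
  idm : forall A, hom A A;
  comp : forall A B C, hom A B -> hom B C -> hom A C;
  comp1m : forall A B (f : hom A B), comp (idm A) f = f;
  compm1 : forall A B (f : hom A B), comp f (idm B) = f;
  compA : forall A B C D (f : hom A B) (g : hom B C) (h : hom C D),
    comp (comp f g) h = comp f (comp g h)
}.

Arguments hom {c} A B.
Arguments idm {c} A.
Arguments comp {c A B C} f g.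

(* Diagrammatic order: [f ;; g] is [f] followed by [g]. *)
Notation "f ;; g" := (comp f g) : rcat_scope.

Record restriction_category := RestrictionCategory {
  rcat :> category;
  restr : forall A B : rcat, hom A B -> hom A A;
  R1 : forall (A B : rcat) (f : hom A B), restr f ;; f = f;
  R2 : forall (A B C : rcat) (f : hom A B) (g : hom A C),
    restr f ;; restr g = restr g ;; restr f;
  R3 : forall (A B C : rcat) (f : hom A B) (g : hom A C),
    restr (restr f ;; g) = restr f ;; restr g;
  R4 : forall (A B C : rcat) (f : hom A B) (g : hom B C),
    f ;; restr g = restr (f ;; g) ;; f
}.

Arguments restr {r A B} f.

Definition rle (X : restriction_category) (A B : X) (f g : hom A B) : Prop :=
  restr f ;; g = f.

Definition compatible (X : restriction_category) (A B : X) (f g : hom A B)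
    : Prop :=
  restr g ;; f = restr f ;; g.

(* Makes the right-hand side of [join_precomp] below well defined. *)
Lemma compatible_precomp (X : restriction_category) (A' A B : X)
    (k : hom A' A) (f g : hom A B) :
  compatible f g -> compatible (k ;; f) (k ;; g).
Proof.
rewrite /compatible => fg.
by rewrite -!compA -!R4 !compA fg.
Qed.

(* The join is a partial operation: it is applied to a pair of parallel maps
   together with a proof of their compatibility. *)
Record binary_joins (X : restriction_category) := BinaryJoins {
  join : forall (A B : X) (f g : hom A B), compatible f g -> hom A B;
  join_ubl : forall (A B : X) (f g : hom A B) (fg : compatible f g),
    rle f (join fg);
  join_ubr : forall (A B : X) (f g : hom A B) (fg : compatible f g),
    rle g (join fg);
  join_least : forall (A B : X) (f g : hom A B) (fg : compatible f g)
    (h : hom A B), rle f h -> rle g h -> rle (join fg) h;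
  join_precomp : forall (A' A B : X) (f g : hom A B) (fg : compatible f g)
    (k : hom A' A), k ;; join fg = join (compatible_precomp k fg)
}.

Arguments join {X} b {A B} f g fg : rename.

Record override_restriction_category := OverrideRestrictionCategory {
  ocat :> restriction_category;
  override : forall A B : ocat, hom A B -> hom A B -> hom A B
    where "f |> g" := (override f g);
  overrideA : forall (A B : ocat) (f g h : hom A B),
    (f |> g) |> h = f |> (g |> h);
  override_restrr : forall (A B : ocat) (f g : hom A B),
    f |> (restr f ;; g) = f;
  override_restrl : forall (A B C : ocat) (f : hom A B) (g : hom A C),
    (restr g ;; f) |> f = f;
  override_precomp : forall (A B C : ocat) (f : hom A B) (g h : hom B C),
    f ;; (g |> h) = (f ;; g) |> (f ;; h);
  override_restr : forall (A B C : ocat) (f g : hom A C) (h : hom A B),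
    restr (f |> g) ;; h = (restr f ;; h) |> (restr g ;; h)
}.

Arguments override {o A B} f g.

Notation "f |> g" := (override f g) : rcat_scope.

(* Main.v *)
From mathcomp Require Import ssreflect.
Require Import Defs.
Local Open Scope rcat_scope.

(** Restrictions distribute over [|>] by [override_precomp], and the absorption laws then make
    [f |> g] an upper bound. It is least because [override_restr] rebuilds [f |> g] from the
    restrictions of [h]. *)

Lemma rle_overridel (X : override_restriction_category) (A B : X)
    (f g : hom A B) : rle f (f |> g).
Proof. by rewrite /rle override_precomp R1 override_restrr. Qed.

(** Compatibility turns [restr g ;; f] into [restr f ;; g], which [override_restrl] absorbs into
    [g]. *)
Lemma rle_overrider (X : override_restriction_category) (A B : X)
    (f g : hom A B) : compatible f g -> rle g (f |> g).
Proof. by rewrite /rle override_precomp R1 => ->; rewrite override_restrl. Qed.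

Lemma override_least (X : override_restriction_category) (A B : X)
    (f g h : hom A B) : rle f h -> rle g h -> rle (f |> g) h.
Proof. by rewrite /rle override_restr => -> ->. Qed.

Theorem theorem15 (X : override_restriction_category) :
  exists J : binary_joins X,
    forall (A B : X) (f g : hom A B) (fg : compatible f g),
      join J f g fg = f |> g.
Proof.
unshelve eexists.
  apply: (@BinaryJoins X (fun A B f g _ => f |> g)) => *.
  - exact: rle_overridel.
  - exact: rle_overrider.
  - exact: override_least.
  (* The chosen join ignores the compatibility proof, so this is the axiom itself. *)
  - exact: override_precomp.
by [].
Qed.
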